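(* Consider the formation control system \[ \dot p_i=\sum_{j\in\mathcal{N}_i}(p_j-p_i)\big(\|p_j-p_i\|^2-d_{ij}^2\big)+\sum_{j\in\mathcal{N}_i^o}\Big((p_j-p_i)-(\hat p_j-\hat p_i)\Big),\quad i=1,\dots,n, \] equivalently $\dot p=-R(p)^Te(p)-(L_o\otimes I_d)\bar p$. Suppose the target formation is infinitesimally rigid and the initial positions of all agents are chosen such that the initial formation is sufficiently close to the desired (target) formation. Then the solution converges to the desired equilibrium set \[ \mathcal{M}=\{p\in\mathbb{R}^{dn}:\ e(p)=0,\ p_i-p_j=\hat p_i-\hat p_j\ \ \forall (i,j)\in\mathcal{E}_o\}, \] i.e. to the correct formation shape and orientation, and this convergence is (locally) exponentially fast.
   Context: Let $d\in\{2,3\}$, $n\ge2$ agents with positions $p_i\in\mathbb{R}^d$ (single integrators), $p\in\mathbb{R}^{dn}$ stacked. $\mathcal{G}=(\mathcal{V},\mathcal{E})$ is an undirected graph on $\{1,\dots,n\}$ with $m$ edges, $\mathcal{N}_i=\{j:(i,j)\in\mathcal{E}\}$; each edge $k$ is given an arbitrary orientation (head $j$, tail $i$) and $H\in\mathbb{R}^{m\times n}$ is the incidence matrix ($h_{ki}=1$ if edge $k$ sinks at $i$, $-1$ if it leaves $i$, $0$ otherwise). $z=(H\otimes I_d)p$, $z_k=p_j-p_i$, $Z(z)=\mathrm{diag}(z_1,\dots,z_m)$ block diagonal, rigidity matrix $R(p)=Z(z)^T(H\otimes I_d)$; a framework $(\mathcal{G},p)$ is infinitesimally rigid iff $\mathrm{rank}\,R(p)=dn-d(d+1)/2$.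 Each edge $k=(i,j)$ has desired distance $d_k=d_{ij}>0$ and error $e_k=\|p_i-p_j\|^2-d_k^2$, $e=[e_1,\dots,e_m]^T$. Orientation edges $\mathcal{E}_o\subseteq\mathcal{E}$ define the graph $\mathcal{G}_o=(\mathcal{V},\mathcal{E}_o)$ with neighbor sets $\mathcal{N}_i^o$ and Laplacian $L_o$; for $(i,j)\in\mathcal{E}_o$ a desired relative vector $\hat p_j-\hat p_i$ with $\|\hat p_j-\hat p_i\|=d_{ij}$ is given; $\bar p_i=p_i-\hat p_i$ if $i$ is incident to an edge of $\mathcal{E}_o$ and $\bar p_i=0$ otherwise. The orientation edges are selected as follows: all edges of $\mathcal{E}_o$ are incident to a common agent $i_0$; if $d=2$, $\mathcal{E}_o\neq\emptyset$; if $d=3$, $\mathcal{E}_o$ contains two edges $(i_0,j),(i_0,j')$ whose desired vectors $\hat p_j-\hat p_{i_0},\hat p_{j'}-\hat p_{i_0}$ are linearly independent. A target formation is a point $\tilde p\in\mathcal{M}$, i.e. satisfying all distance constraints $\|\tilde p_i-\tilde p_j\|=d_{ij}$, $(i,j)\in\mathcal{E}$, and all orientation constraints $\tilde p_i-\tilde p_j=\hat p_i-\hat p_j$, $(i,j)\in\mathcal{E}_o$. *)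

(* Defs.v *)
From HB Require Import structures.
From mathcomp Require Import all_boot all_order all_algebra.
From mathcomp Require Import all_classical all_reals all_analysis.
Set Implicit Arguments. Unset Strict Implicit. Unset Printing Implicit Defensive.
Import Order.TTheory GRing.Theory Num.Theory.
Import numFieldNormedType.Exports.
Local Open Scope ring_scope.

(* Configurations of n agents in R^d: row i of p : 'M_(n,d) is p_i.
   The stacked vector p in R^{dn} is mxvec p. *)

Definition sqnorm (R : realType) (d : nat) (v : 'rV[R]_d) : R :=
  \sum_(k < d) v 0 k ^+ 2.

Definition enorm (R : realType) (d : nat) (v : 'rV[R]_d) : R :=
  Num.sqrt (sqnorm v).

(* The graph: E is a symmetric irreflexive relation on 'I_n (hypotheses of
   the theorem).  Edge set: unordered pairs, represented by (i,j) with i < j,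
   oriented with tail i and head j, so z_k = p_j - p_i. *)
Definition edges (n : nat) (E : rel 'I_n) : {set 'I_n * 'I_n} :=
  [set ij | E ij.1 ij.2 && (ij.1 < ij.2)%N].

Definition incid (R : realType) (n : nat) (ij : 'I_n * 'I_n) (l : 'I_n) : R :=
  if l == ij.2 then 1 else if l == ij.1 then -1 else 0.

(* Rigidity matrix R(p) = Z(z)^T (H ⊗ I_d), rows indexed by the edges,
   columns by the stacked coordinates (agent l, coordinate c). *)
Definition rigidity_matrix (R : realType) (n d : nat) (E : rel 'I_n)
  (p : 'M[R]_(n, d)) : 'M[R]_(#|edges E|, n * d) :=
  \matrix_(k < #|edges E|)
    (let ij := enum_val k in
     mxvec (\matrix_(l < n) (incid R ij l *: (row ij.2 p - row ij.1 p)))).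

Definition inf_rigid (R : realType) (n d : nat) (E : rel 'I_n)
  (p : 'M[R]_(n, d)) : Prop :=
  \rank (rigidity_matrix E p) = (n * d - (d * d.+1) %/ 2)%N.

Definition in_M (R : realType) (n d : nat) (E Eo : rel 'I_n)
  (dd : 'I_n -> 'I_n -> R) (phat : 'M[R]_(n, d)) (p : 'M[R]_(n, d)) : Prop :=
  (forall i j, E i j -> sqnorm (row i p - row j p) = dd i j ^+ 2) /\
  (forall i j, Eo i j -> row i p - row j p = row i phat - row j phat).

Definition formation_field (R : realType) (n d : nat) (E Eo : rel 'I_n)
  (dd : 'I_n -> 'I_n -> R) (phat : 'M[R]_(n, d)) (p : 'M[R]_(n, d))
  : 'M[R]_(n, d) :=
  \matrix_(i < n)
    ((\sum_(j < n | E i j)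
        (sqnorm (row j p - row i p) - dd i j ^+ 2) *: (row j p - row i p))
     + \sum_(j < n | Eo i j)
        ((row j p - row i p) - (row j phat - row i phat))).

(* Main.v *)
Require Import Defs.
From HB Require Import structures.
From mathcomp Require Import all_boot all_order all_algebra.
From mathcomp Require Import all_classical all_reals all_analysis.
From mathcomp Require Import ring lra.
Import Order.TTheory GRing.Theory Num.Theory.
Import numFieldNormedType.Exports.
Local Open Scope classical_set_scope.
Local Open Scope ring_scope.

(* On the configurations with a prescribed centroid the target formation [x] is
   an isolated equilibrium, so exponential stability can be read off the squared
   distance [W = \sum_i |q_i|^2], [q = p - x], directly: with [z = x_j - x_i],
   [w = q_j - q_i], the interaction terms of [W'] are
   [- (2 z.w + |w|^2) (z.w + |w|^2) <= - (z.w)^2 + 5/4 |w|^4], plus [- |w|^2] on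
   the orientation edges.  The quadratic form [\sum_E (z.w)^2 + \sum_Eo |w|^2] is
   positive definite on centered [q]: by a dimension count, infinitesimal rigidity
   says that its first part vanishes only on infinitesimal rigid motions, and the
   orientation edges exclude rotations.  Hence [W' <= - k W + O(W^2)].  The centroid
   is a constant of motion, so the limit is the translate of the target that has
   the centroid of [p 0]. *)

Set Implicit Arguments.
Unset Strict Implicit.
Unset Printing Implicit Defensive.

(** * Monotonicity and Gronwall decay of scalar functions on the half-line *)

(** The derivative is only known at positive times, so the mean value theorem is completed at [0] by
    right continuity, the regularity assumed of a solution. *)
Lemma nonincreasing_right (R : realType) (f f' : R -> R) (t : R) : 0 <= t ->
  (forall s : R, 0 < s -> is_derive s 1 f (f' s)) -> f x @[x --> 0^'+] --> f 0 ->
  (forall s, 0 < s < t -> f' s <= 0) -> f t <= f 0.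
Proof.
rewrite le_eqVlt => /predU1P[<- //|t0] df f0 f'0.
have fc s : 0 < s -> {for s, continuous f}.
  by move=> /df [/derivable1_diffP/differentiable_continuous].
have [||s] := @MVT _ f f' 0 t t0.
- by move=> s; rewrite in_itv/= => /andP[/df].
- apply/continuous_within_itvP => //; split=> //.
    by move=> s; rewrite in_itv/= => /andP[/fc].
  by apply: cvg_at_left_filter; exact: fc.
rewrite in_itv/= subr0 => s0t fE.
by rewrite -subr_le0 fE mulr_le0_ge0 ?f'0// ltW.
Qed.

Lemma constant_right (R : realType) (f : R -> R) (t : R) : 0 <= t ->
  (forall s : R, 0 < s -> is_derive s 1 f 0) -> f x @[x --> 0^'+] --> f 0 ->
  f t = f 0.
Proof.
move=> t0 df f0; apply/eqP; rewrite eq_le; apply/andP; split.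
  by apply: (nonincreasing_right t0 df).
rewrite -lerN2; apply: (@nonincreasing_right _ (- f) (fun=> - 0) _ t0) => //.
- by move=> s s0; apply: is_deriveN; exact: df.
- exact: cvgN.
Qed.

(* The bound on the derivative is only known while [W < r]; the infimum of the
   times at which [W >= r] would be a first exit, before which [W] decreases. *)
Lemma local_gronwall (R : realType) (W W' : R -> R) (c r : R) : 0 <= c ->
  (forall s : R, 0 < s -> is_derive s 1 W (W' s)) -> W x @[x --> 0^'+] --> W 0 ->
  (forall s, 0 <= W s) ->
  (forall s, 0 < s -> W s < r -> W' s <= - c * W s) -> W 0 < r ->
  forall t, 0 <= t -> W t <= W 0 * expR (- (c * t)).
Proof.
move=> c0 dW W0 Wge0 W'c W0r.
have Wc s : 0 < s -> {for s, continuous W}.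
  by move=> /dW [/derivable1_diffP/differentiable_continuous].
have Wr t : 0 <= t -> W t < r.
  move=> t0; rewrite ltNge; apply/negP => rWt.
  pose A := [set s | 0 <= s /\ r <= W s].
  have At : A t by [].
  have lbA : lbound A 0 by move=> s [].
  have hiA : has_inf A by split; [exists t|exists 0].
  have inf0 : 0 <= inf A by apply: lb_le_inf; [exists t|].
  have Wlt s : 0 <= s -> s < inf A -> W s < r.
    move=> s0 sA; rewrite ltNge; apply/negP => rWs.
    by move: sA; rewrite ltNge => /negP; apply; apply: ge_inf => //; exists 0.
  have : W (inf A) <= W 0.
    apply: (nonincreasing_right inf0 dW W0) => s /andP[s0 sA].
    rewrite (le_trans (W'c _ s0 (Wlt _ (ltW s0) sA)))//.
    by rewrite mulNr oppr_le0 mulr_ge0.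
  move=> /le_lt_trans /(_ W0r) WA.
  (* Right continuity at [inf A] keeps [W] below [r] slightly past the infimum of [A], which is
     absurd; if [inf A = 0] it is the hypothesis at [0]. *)
  have [e e0 eA] : exists2 e, 0 < e & forall s, inf A <= s -> s < inf A + e -> W s < r.
    have WcA : W x @[x --> (inf A)^'+] --> W (inf A).
      move: inf0; rewrite le_eqVlt => /predU1P[<- //|iA0].
      by apply: cvg_at_right_filter; exact: Wc.
    have /nbhs_ballP[e /= e0 eW] : \forall s \near (inf A)^'+, W s < r.
      exact: (cvgr_lt (W (inf A))).
    exists e => // s; rewrite le_eqVlt => /predU1P[<- //|As] sAe.
    by apply: eW => //; rewrite /ball/= ltr0_norm ?subr_lt0// opprB ltrBlDl.
  have [s [s0 rWs] sAe] := inf_adherent e0 hiA.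
  by have := eA s (ge_inf (ex_intro _ _ lbA) (conj s0 rWs)) sAe; rewrite ltNge rWs.
move=> t t0.
(* Integrating factor: the product with [expR (c * t)] is nonincreasing. *)
have H : W t * expR (c * t) <= W 0 * expR (c * 0).
  apply: (@nonincreasing_right _ (fun t => W t * expR (c * t))
     (fun s => (W' s + c * W s) * expR (c * s)) _ t0).
  - move=> s s0.
    have ? := dW _ s0.
    have de : is_derive s 1 (fun u : R => expR (c * u)) (expR (c * s) * c).
      have := @is_derive1_comp R expR ( *%R c) s _ _ (is_derive_expR _); apply.
      by rewrite -[X in is_derive _ _ _ X](mulr1 c); exact: is_deriveZ.
    apply: (is_derive_eq (is_deriveM _ de)).
    by rewrite /GRing.scale/=; ring.
  - apply: cvgM => //.
    apply: (@cvg_at_right_filter _ _ (fun x => expR (c * x))).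
    apply: continuous_comp; last exact: continuous_expR.
    exact: mulrl_continuous.
  - move=> s /andP[s0 _]; rewrite mulr_le0_ge0 ?expR_ge0//.
    by rewrite -lerBrDr sub0r -mulNr W'c ?Wr ?ltW.
by rewrite expRN -ler_pdivrMr ?invr_gt0 ?expR_gt0// invrK; rewrite mulr0 expR0 mulr1 in H.
Qed.

(** * Coercivity from finitely many linear forms *)

Section Coercivity.
Variables (R : realType) (n d : nat).
Implicit Types q : 'M[R]_(n, d).

(** The forms make up a matrix [A] with trivial left kernel, hence with a right inverse [B], whose
    entries bound [q] by the values [L t q]. *)
Lemma coercive_of_trivial_kernel (T : finType) (L : T -> 'M[R]_(n, d) -> R) :
  (forall t a u v, L t (a *: u + v) = a * L t u + L t v) ->
  (forall q, (forall t, L t q = 0) -> q = 0) ->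
  exists2 k : R, 0 < k & forall q, k * \sum_i sqnorm (row i q) <= \sum_t L t q ^+ 2.
Proof.
move=> Llin Lker.
have L0 t : L t 0 = 0.
  by have := Llin t (- 1) 0 0; rewrite scaler0 addr0 mulN1r addNr.
have LZ t a u : L t (a *: u) = a * L t u.
  by have := Llin t a u 0; rewrite !addr0 L0 addr0.
have Lsum t (I : finType) (a : I -> R) (u : I -> 'M[R]_(n, d)) :
    L t (\sum_i a i *: u i) = \sum_i a i * L t (u i).
  have LD : {morph L t : u v / u + v}.
    by move=> x y; rewrite -{1}[x]scale1r Llin mul1r.
  by rewrite (big_morph _ LD (L0 t)); apply: eq_bigr => i _; exact: LZ.
pose A : 'M[R]_(n * d, #|T|) :=
  \matrix_(r, k) L (enum_val k) (vec_mx (delta_mx 0 r)).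
have AE q : mxvec q *m A = \row_k L (enum_val k) q.
  apply/rowP => k; rewrite !mxE.
  have qE : q = \sum_r mxvec q 0 r *: vec_mx (delta_mx 0 r).
    rewrite -[LHS]mxvecK [in LHS](row_sum_delta (mxvec q)) linear_sum.
    by apply: eq_bigr => r _; rewrite linearZ.
  by rewrite [in RHS]qE Lsum; apply: eq_bigr => r _; rewrite mxE.
have /row_freeP[B AB] : row_free A.
  apply/inj_row_free => v vA; rewrite -[v]vec_mxK.
  rewrite (Lker (vec_mx v)) ?linear0// => t.
  have := AE (vec_mx v); rewrite vec_mxK vA => /rowP/(_ (enum_rank t)).
  by rewrite !mxE enum_rankK.
pose b := \sum_j (\sum_k `|B k j|) ^+ 2.
have b0 : 0 <= b by apply: sumr_ge0 => j _; exact: sqr_ge0.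
(* Since [b] may be [0], adding [1] keeps the constant positive. *)
exists (1 + b)^-1; first by rewrite invr_gt0 ltr_pwDl.
move=> q; set Y := (X in _ <= X).
have Y0 : 0 <= Y by apply: sumr_ge0 => t _; exact: sqr_ge0.
have LY t : `|L t q| <= Num.sqrt Y.
  rewrite -sqrtr_sqr ler_wsqrtr// /Y (bigD1 t)//= lerDl.
  by apply: sumr_ge0 => s _; exact: sqr_ge0.
have qE j : `|mxvec q 0 j| ^+ 2 <= Y * (\sum_k `|B k j|) ^+ 2.
  rewrite -(sqr_sqrtr Y0) -exprMn lerXn2r ?nnegrE ?mulr_ge0 ?sqrtr_ge0 ?sumr_ge0//.
  rewrite -[mxvec q]mulmx1 -AB mulmxA AE mxE mulr_sumr.
  rewrite (le_trans (ler_norm_sum _ _ _))// ler_sum// => k _.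
  by rewrite normrM mxE ler_wpM2r.
rewrite ler_pdivrMl ?ltr_pwDl//.
apply: (@le_trans _ _ (\sum_j `|mxvec q 0 j| ^+ 2)).
  rewrite [leRHS](reindex _ (curry_mxvec_bij n d)) /=.
  rewrite /sqnorm pair_bigA ler_sum//= => -[i j] _ /=.
  by rewrite !mxE mxvecE real_normK ?num_real.
rewrite (le_trans (ler_sum _ (fun j _ => qE j)))// -mulr_sumr mulrC.
by rewrite ler_wpM2r// lerDr.
Qed.
End Coercivity.

(** * The Euclidean inner product of row vectors *)

Definition dot (R : realType) (d : nat) (u v : 'rV[R]_d) : R := (u *m v^T) 0 0.

Section Dot.
Variables (R : realType) (d : nat).
Implicit Types (u v w : 'rV[R]_d) (a : R).

Lemma dotE u v : dot u v = \sum_c u 0 c * v 0 c.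
Proof. by rewrite /dot mxE; apply: eq_bigr => c _; rewrite mxE. Qed.

Lemma sqnormE u : sqnorm u = dot u u.
Proof. by rewrite dotE; apply: eq_bigr. Qed.

Lemma sqnorm_ge0 u : 0 <= sqnorm u.
Proof. by apply: sumr_ge0 => c _; exact: sqr_ge0. Qed.

Lemma sqnorm_eq0 u : (sqnorm u == 0) = (u == 0).
Proof.
rewrite psumr_eq0; last by move=> c _; exact: sqr_ge0.
apply/allP/eqP => [u0|-> c _]; last by rewrite /= mxE expr0n eqxx.
by apply/rowP => c; have := u0 c (mem_index_enum c); rewrite /= sqrf_eq0 mxE => /eqP.
Qed.

Lemma dotC u v : dot u v = dot v u.
Proof. by rewrite /dot -[in LHS](trmxK u) -trmx_mul mxE. Qed.

Lemma dotDl u v w : dot (u + v) w = dot u w + dot v w.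
Proof. by rewrite /dot mulmxDl mxE. Qed.

Lemma dotZl a u w : dot (a *: u) w = a * dot u w.
Proof. by rewrite /dot -scalemxAl mxE. Qed.

Lemma dotDr u v w : dot u (v + w) = dot u v + dot u w.
Proof. by rewrite !(dotC u) dotDl. Qed.

Lemma dotZr a u w : dot u (a *: w) = a * dot u w.
Proof. by rewrite !(dotC u) dotZl. Qed.

Lemma dotNr u w : dot u (- w) = - dot u w.
Proof. by rewrite -scaleN1r dotZr mulN1r. Qed.

Lemma dotBr u v w : dot u (v - w) = dot u v - dot u w.
Proof. by rewrite dotDr dotNr. Qed.

Lemma dot0r u : dot u 0 = 0.
Proof. by rewrite -(scale0r 0) dotZr mul0r. Qed.

Lemma dot_sumr (I : finType) (P : pred I) u (F : I -> 'rV[R]_d) :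
  dot u (\sum_(i | P i) F i) = \sum_(i | P i) dot u (F i).
Proof. exact: (big_morph _ (fun v w => dotDr u v w) (dot0r u)). Qed.

(** The scalar [u S u^T] equals its transpose, hence its own opposite. This is why infinitesimal
    rotations preserve lengths to first order. *)
Lemma dot_skew u (S : 'M[R]_d) : S^T = - S -> dot u (u *m S) = 0.
Proof.
move=> ST; suff : dot u (u *m S) = - dot u (u *m S) by lra.
by rewrite {1}dotC -dotNr /dot -mulmxN trmx_mul -ST trmxK mulmxA.
Qed.

Lemma sqnormD u v : sqnorm (u + v) = sqnorm u + dot u v *+ 2 + sqnorm v.
Proof. by rewrite !sqnormE dotDl !dotDr (dotC v u) mulr2n !addrA. Qed.

Lemma sqnormN u : sqnorm (- u) = sqnorm u.
Proof. by apply: eq_bigr => c _; rewrite mxE sqrrN. Qed.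

(** By the parallelogram identity the two sides differ by [sqnorm (u + v)]. *)
Lemma sqnormB_le u v : sqnorm (u - v) <= 2 * (sqnorm u + sqnorm v).
Proof.
have := sqnorm_ge0 (u + v); rewrite !sqnormD dotNr sqnormN; lra.
Qed.

End Dot.

(** * Infinitesimal rigid motions and the kernel of the rigidity matrix *)

Section RigidMotions.
Variables (R : realType) (n d : nat).
Implicit Types (E : rel 'I_n) (p q : 'M[R]_(n, d)).

(** Only the two endpoints of an edge have a nonzero incidence. *)
Lemma mul_rigidity_matrix E p q k :
  (mxvec q *m (rigidity_matrix E p)^T) 0 k =
  dot (row (enum_val k).2 p - row (enum_val k).1 p)
      (row (enum_val k).2 q - row (enum_val k).1 q).
Proof.
have := enum_valP k; rewrite inE; set ij := enum_val k => /andP[_ ltij].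
have neij : ij.1 != ij.2 by rewrite neq_ltn ltij.
set z := row ij.2 p - row ij.1 p.
transitivity (\sum_l incid R ij l * dot z (row l q)).
  rewrite mxE (reindex _ (curry_mxvec_bij n d)) /=.
  under [RHS]eq_bigr do rewrite dotE mulr_sumr.
  rewrite pair_bigA; apply: eq_bigr => -[l c] _ /=.
  by rewrite mxvecE !mxE -/ij mxvecE !mxE; ring.
rewrite (bigD1 ij.2)//= (bigD1 ij.1)//= big1 => [|l /andP[/negbTE l2 /negbTE l1]].
  by rewrite /incid !eqxx (negbTE neij) dotBr; ring.
by rewrite /incid l1 l2 mul0r.
Qed.

(* The matrices [J k] span the skew-symmetric ones, and [m + d <= n * d] rules out
   truncation in the subtraction defining [inf_rigid]. *)
Lemma inf_rigid_kernel E p q m (J : 'I_m -> 'M[R]_d)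
    (Eo : rel 'I_n) :
  (0 < n)%N -> (m + d = (d * d.+1) %/ 2)%N -> (m + d <= n * d)%N ->
  (forall k, (J k)^T = - J k) ->
  (forall a : 'rV_m, (forall i j, Eo i j ->
     (row i p - row j p) *m (\sum_k a 0 k *: J k) = 0) -> a = 0) ->
  inf_rigid E p ->
  (forall i j, E i j -> dot (row j p - row i p) (row j q - row i q) = 0) ->
  (forall i j, Eo i j -> row i q = row j q) ->
  forall i j, row i q = row j q.
Proof.
move=> n0 dm nd Jskew Jinj rigid qE qEo.
pose S (a : 'rV_m) := \sum_k a 0 k *: J k.
have Sskew a : (S a)^T = - S a.
  rewrite /S raddf_sum -sumrN; apply: eq_bigr => k _.
  have /matrixP Jk := Jskew k; apply/matrixP => i j.
  by have := Jk i j; rewrite !mxE => ->; rewrite mulrN.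
(* The rows of [Phi] are the [m] rotations [p *m J k] and the [d] translations; [row_mx a c]
   combines them into [mot a c]. *)
pose Phi := col_mx (\matrix_(k < m) mxvec (p *m J k))
  (\matrix_(k < d) mxvec ((const_mx 1 : 'cV_n) *m (delta_mx 0 k : 'rV_d))).
pose mot a c : 'M[R]_(n, d) := p *m S a + (const_mx 1 : 'cV_n) *m c.
have PhiE (a : 'rV_m) c : row_mx a c *m Phi = mxvec (mot a c).
  rewrite mul_row_col linearD/= !mulmx_sum_row; congr (_ + _).
    rewrite /S mulmx_sumr linear_sum; apply: eq_bigr => k _ /=.
    by rewrite rowK -scalemxAr linearZ.
  rewrite [in RHS](row_sum_delta c) mulmx_sumr linear_sum; apply: eq_bigr => k _ /=.
  by rewrite rowK -scalemxAr linearZ.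
have row_mot a c i : row i (mot a c) = row i p *m S a + c.
  rewrite /mot linearD/= !row_mul; congr (_ + _).
  by apply/rowP => k; rewrite mxE big_ord1 !mxE mul1r.
have mot_diff a c i j : row i (mot a c) - row j (mot a c) = (row i p - row j p) *m S a.
  by rewrite !row_mot opprD addrACA subrr addr0 mulmxBl.
have Phi_ker (u : 'rV_(m + d)) : u *m Phi *m (rigidity_matrix E p)^T = 0.
  rewrite -[u]hsubmxK PhiE; apply/rowP => k.
  by rewrite mul_rigidity_matrix mot_diff dot_skew// mxE.
have free : row_free Phi.
  apply/inj_row_free => u; rewrite -[u]hsubmxK PhiE => /eqP.
  rewrite mxvec_eq0 => /eqP mot0.
  have a0 : lsubmx u = 0.
    by apply: Jinj => i j _; rewrite -/(S _) -(mot_diff _ (rsubmx u)) mot0 !row0 subrr.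
  have := row_mot (lsubmx u) (rsubmx u) (Ordinal n0); rewrite mot0 a0 row0.
  rewrite /S big1 => [|k _]; last by rewrite mxE scale0r.
  by rewrite mulmx0 add0r => <-; rewrite row_mx0.
have Phi_le : (Phi <= kermx (rigidity_matrix E p)^T)%MS.
  apply/sub_kermxP/row_matrixP => k.
  by rewrite row_mul rowE Phi_ker row0.
(* The kernel has rank [n * d - (n * d - (m + d)) = m + d], which is the rank of [Phi], so the
   inclusion is an equality. *)
have ker_le : (kermx (rigidity_matrix E p)^T <= Phi)%MS.
  rewrite -(geq_leqif (mxrank_leqif_sup Phi_le)) mxrank_ker mxrank_tr rigid.
  by rewrite -dm subKn// (eqP free).
have /submx_trans/(_ ker_le)/submxP[u] : (mxvec q <= kermx (rigidity_matrix E p)^T)%MS.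
  apply/sub_kermxP/rowP => k; rewrite mul_rigidity_matrix mxE qE//.
  by have := enum_valP k; rewrite inE => /andP[].
rewrite -[u]hsubmxK PhiE => /(can_inj mxvecK) qmot.
(* Now [q] is a rigid motion; its constancy along [Eo] kills the rotation and leaves a
   translation. *)
have a0 : lsubmx u = 0.
  apply: Jinj => i j /qEo; rewrite -/(S _) -(mot_diff _ (rsubmx u)) -qmot => ->.
  exact: subrr.
move=> i j; rewrite qmot !row_mot a0.
rewrite /S big1 => [|k _]; last by rewrite mxE scale0r.
by rewrite !mulmx0.
Qed.
End RigidMotions.

(** * The stiffness form and dissipation by the formation field *)

Section Estimates.
Variables (R : realType) (n d : nat).
Implicit Types (E Eo : rel 'I_n) (p q x phat : 'M[R]_(n, d)).

(** The centroid coordinates are added to the linear forms to exclude translations from the kernel;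
    on centered [q] they vanish and leave the sum. *)
Lemma stiffness_coercive E Eo x : (0 < n)%N ->
  (forall q,
    (forall i j, E i j -> dot (row j x - row i x) (row j q - row i q) = 0) ->
    (forall i j, Eo i j -> row i q = row j q) ->
    forall i j, row i q = row j q) ->
  exists2 k : R, 0 < k & forall q, \sum_i row i q = 0 ->
    k * \sum_i sqnorm (row i q) <=
    \sum_i \sum_(j | E i j) dot (row j x - row i x) (row j q - row i q) ^+ 2
    + \sum_i \sum_(j | Eo i j) sqnorm (row j q - row i q).
Proof.
move=> n0 ker.
(* In order: stretching of edges, coordinates along orientation edges, centroid coordinates. Pairs
   outside the graphs get the zero form. *)
pose L (t : ('I_n * 'I_n) + ('I_n * 'I_n * 'I_d) + 'I_d) q : R :=
  match t with
  | inl (inl (i, j)) =>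
      if E i j then dot (row j x - row i x) (row j q - row i q) else 0
  | inl (inr (i, j, c)) => if Eo i j then (row j q - row i q) 0 c else 0
  | inr c => \sum_i q i c
  end.
have [||k k0 kL] := @coercive_of_trivial_kernel R n d _ L.
- move=> [[[i j]|[[i j] c]]|c] a u v /=.
  + case: ifP => _; last by rewrite mulr0 addr0.
    have -> : row j (a *: u + v) - row i (a *: u + v) =
        a *: (row j u - row i u) + (row j v - row i v).
      by rewrite scalerBr addrACA -opprD; congr (_ - _); rewrite linearP.
    by rewrite [LHS]dotDr [in LHS]dotZr.
  + by case: ifP => _; rewrite ?mxE; ring.
  + by rewrite mulr_sumr -big_split; apply: eq_bigr => i _; rewrite !mxE.
- move=> q L0.
  have qrow i j : row i q = row j q.
    apply: ker i j => i j ij; first by have := L0 (inl (inl (i, j))); rewrite /= ij.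
    apply/rowP => c; have := L0 (inl (inr (i, j, c))).
    by rewrite /= ij mxE [in X in _ + X]mxE => /eqP; rewrite subr_eq0 => /eqP.
  apply/matrixP => i c; have := L0 (inr c).
  rewrite /= (eq_bigr (fun=> q i c)) => [|j _].
    rewrite sumr_const card_ord => /eqP; rewrite mulrn_eq0 eqn0Ngt n0 => /eqP ->.
    by rewrite mxE.
  by have /rowP/(_ c) := qrow j i; rewrite !mxE.
exists k => // q q0; rewrite (le_trans (kL q))//.
rewrite !big_sumType/= [X in _ + X <= _]big1 ?addr0 => [|c _]; last first.
  have /rowP/(_ c) := q0; rewrite summxE mxE => qc0.
  by rewrite (eq_bigr (fun i => row i q 0 c)) ?qc0 ?expr0n// => i _; rewrite mxE.
apply: lerD; rewrite le_eqVlt; apply/predU1P; left.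
  under [RHS]eq_bigr do rewrite big_mkcond.
  rewrite pair_bigA; apply: eq_bigr => -[i j] _ /=.
  by case: ifP => // _; rewrite expr0n.
under [RHS]eq_bigr do rewrite big_mkcond.
rewrite pair_bigA/=.
rewrite [RHS](eq_bigr (fun ij : 'I_n * 'I_n => \sum_c
    (if Eo ij.1 ij.2 then (row ij.2 q - row ij.1 q) 0 c else 0) ^+ 2)) => [|[i j] _] /=.
  by rewrite pair_bigA; apply: eq_bigr => -[[i j] c].
by case: ifP => // _; rewrite big1// => c _; rewrite expr0n.
Qed.

(** Summation by parts, by exchanging [i] and [j]; each edge occurs in both orders, hence the factor
    [2^-1]. *)
Lemma sum_dot_antisym (G : rel 'I_n) (f : 'I_n -> 'I_n -> 'rV[R]_d) q :
  (forall i j, G i j = G j i) -> (forall i j, G i j -> f j i = - f i j) ->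
  \sum_i dot (row i q) (\sum_(j | G i j) f i j) =
  - (2^-1 * \sum_i \sum_(j | G i j) dot (f i j) (row j q - row i q)).
Proof.
move=> Gsym fanti.
set S := LHS.
have S1 : S = \sum_i \sum_(j | G i j) dot (f i j) (row i q).
  by apply: eq_bigr => i _; rewrite dot_sumr; apply: eq_bigr => j _; rewrite dotC.
have S2 : S = - \sum_i \sum_(j | G i j) dot (f i j) (row j q).
  rewrite S1 (exchange_big_dep predT)//= -sumrN; apply: eq_bigr => i _.
  rewrite -sumrN; apply: eq_big => [j|j ij]; first by rewrite Gsym.
  by rewrite fanti // 1?Gsym// dotC dotNr dotC.
under eq_bigr do under eq_bigr do rewrite dotBr.
under eq_bigr do rewrite sumrB.
rewrite sumrB -S1 -[X in X - _]opprK -S2; by field.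
Qed.

Lemma formation_field_dot E Eo dd phat p q :
  (forall i j, E i j = E j i) -> (forall i j, E i j -> dd i j = dd j i) ->
  (forall i j, Eo i j = Eo j i) ->
  \sum_i dot (row i q) (row i (formation_field E Eo dd phat p)) =
  - (2^-1 * \sum_i \sum_(j | E i j) (sqnorm (row j p - row i p) - dd i j ^+ 2) *
       dot (row j p - row i p) (row j q - row i q))
  - 2^-1 * \sum_i \sum_(j | Eo i j)
       dot ((row j p - row i p) - (row j phat - row i phat)) (row j q - row i q).
Proof.
move=> Esym ddsym Eosym.
under eq_bigr do rewrite rowK dotDr.
rewrite big_split/= !sum_dot_antisym//.
- by congr (- (_ * _) - _); do 2![apply: eq_bigr => ? _]; rewrite dotC dotZr dotC.
- by move=> i j _; rewrite -[in LHS](opprB (row j p)) -[in LHS](opprB (row j phat)) -opprD.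
- move=> i j ij; rewrite -(opprB (row j p)) sqnormN (ddsym j i) 1?Esym//.
  by rewrite scalerN.
Qed.

(** The field is tested against a common translation of all agents, whose relative displacements
    vanish. *)
Lemma sum_formation_field E Eo dd phat p :
  (forall i j, E i j = E j i) -> (forall i j, E i j -> dd i j = dd j i) ->
  (forall i j, Eo i j = Eo j i) ->
  forall c, \sum_i formation_field E Eo dd phat p i c = 0.
Proof.
move=> Esym ddsym Eosym c.
pose Q : 'M[R]_(n, d) := \matrix_(i < n) delta_mx 0 c.
transitivity (\sum_i dot (row i Q) (row i (formation_field E Eo dd phat p))).
  apply: eq_bigr => i _; rewrite dotE (bigD1 c)//= big1 ?addr0 => [|k /negbTE kc].
    by rewrite rowK [in RHS]mxE [X in _ = _ * X]mxE !eqxx mul1r.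
  by rewrite rowK mxE kc mul0r.
have Q0 i j : row j Q - row i Q = 0 by rewrite !rowK subrr.
rewrite formation_field_dot// !big1 ?mulr0 ?subr0 ?oppr0// => i _; rewrite big1// => j _.
  by rewrite Q0 dot0r.
by rewrite Q0 dot0r mulr0.
Qed.

Lemma formation_field_dissipative E Eo dd phat x q (k : R) :
  (forall i j, E i j = E j i) -> (forall i j, E i j -> dd i j = dd j i) ->
  (forall i j, Eo i j = Eo j i) -> in_M E Eo dd phat x ->
  k * \sum_i sqnorm (row i q) <=
    \sum_i \sum_(j | E i j) dot (row j x - row i x) (row j q - row i q) ^+ 2
    + \sum_i \sum_(j | Eo i j) sqnorm (row j q - row i q) ->
  2 * \sum_i dot (row i q) (row i (formation_field E Eo dd phat (x + q))) <=
  - k * (\sum_i sqnorm (row i q)) +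
    20 * n%:R ^+ 2 * (\sum_i sqnorm (row i q)) ^+ 2.
Proof.
move=> Esym ddsym Eosym [xE xEo]; set W := \sum_i sqnorm (row i q) => kW.
rewrite formation_field_dot// mulrBr mulrN !mulrA divff// !mul1r.
have diff i j : row j (x + q) - row i (x + q) =
    (row j x - row i x) + (row j q - row i q).
  by rewrite addrACA -opprD; congr (_ - _); rewrite linearD.
have qW i : sqnorm (row i q) <= W.
  by rewrite /W (bigD1 i)//= lerDl sumr_ge0// => j _; exact: sqnorm_ge0.
have W0 : 0 <= W by apply: sumr_ge0 => i _; exact: sqnorm_ge0.
(* With [|w|^2 <= 4 W], the error [5/4 |w|^4] is at most [20 W^2] for each of at most [n^2] ordered
   pairs. *)
have bound : \sum_i \sum_(j | E i j) dot (row j x - row i x) (row j q - row i q) ^+ 2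
     - 20 * n%:R ^+ 2 * W ^+ 2 <=
   \sum_i \sum_(j | E i j) (sqnorm (row j (x + q) - row i (x + q)) - dd i j ^+ 2) *
       dot (row j (x + q) - row i (x + q)) (row j q - row i q).
  have -> : 20 * n%:R ^+ 2 * W ^+ 2 = \sum_(i < n) \sum_(j < n) 20 * W ^+ 2.
    by rewrite !sumr_const card_ord -[RHS]mulr_natr -(mulr_natr (20 * W ^+ 2) n); ring.
  rewrite -sumrB ler_sum// => i _.
  apply: (@le_trans _ _ (\sum_(j | E i j)
      (dot (row j x - row i x) (row j q - row i q) ^+ 2 - 20 * W ^+ 2))).
    rewrite [leRHS]sumrB lerB// [leRHS](bigID (E i))/= lerDl sumr_ge0// => j _.
    by rewrite mulr_ge0// sqr_ge0.
  apply: ler_sum => j ij; rewrite diff sqnormD.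
  (* The distance constraints at [x] reduce the edge error to [2 z.w + |w|^2]. *)
  have <- : sqnorm (row j x - row i x) = dd i j ^+ 2.
    by rewrite xE 1?Esym// (ddsym i j).
  set z := row j x - row i x; set w := row j q - row i q.
  rewrite dotDl -sqnormE.
  have w0 := sqnorm_ge0 w.
  have wW : sqnorm w <= 4 * W.
    have := sqnormB_le (row j q) (row i q); have := qW i; have := qW j; rewrite -/w; lra.
  have ww : sqnorm w ^+ 2 <= (4 * W) ^+ 2 by rewrite lerXn2r ?nnegrE// mulr_ge0.
  (* [2 a^2 + 3 a b + b^2 = a^2 - 5/4 b^2 + (a + 3/2 b)^2], [a = z.w], [b = |w|^2] *)
  have sq := sqr_ge0 (dot z w + 3 / 2 * sqnorm w).
  nra.
(* The orientation term is affine and vanishes at [x], so it leaves no remainder. *)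
have -> : \sum_i \sum_(j | Eo i j)
       dot (row j (x + q) - row i (x + q) - (row j phat - row i phat)) (row j q - row i q)
   = \sum_i \sum_(j | Eo i j) sqnorm (row j q - row i q).
  apply: eq_bigr => i _; apply: eq_bigr => j ij.
  by rewrite diff (xEo _ _ _) 1?Eosym// addrAC subrr add0r sqnormE.
lra.
Qed.
End Estimates.

(** * Coordinatewise calculus and the max norm of matrices *)

Section Coordinates.
Variables (R : realType) (n d : nat).

Lemma is_derive_coord (p : R -> 'M[R]_(n, d)) (D : 'M[R]_(n, d)) (t : R) i j :
  is_derive t 1 p D -> is_derive t 1 (fun s => p s i j) (D i j).
Proof.
move=> [dp <-]; rewrite (derive_mx dp) mxE.
by apply: DeriveDef => //; move/derivable_mxP : dp; exact.
Qed.

Lemma is_derive_pointwise_sum (m : nat) (h : 'I_m -> R -> R) (dh : 'I_m -> R) (t : R) :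
  (forall i, is_derive t 1 (h i) (dh i)) ->
  is_derive t 1 (fun s => \sum_i h i s) (\sum_i dh i).
Proof.
move=> dhi; rewrite (_ : (fun s => _) = \sum_i h i); last first.
  by apply/funext => s; rewrite fct_sumE.
exact: is_derive_sum.
Qed.

Lemma cvg_pointwise_sum (F : set_system R) {FF : Filter F} (m : nat)
    (h : 'I_m -> R -> R) (l : 'I_m -> R) :
  (forall i, h i x @[x --> F] --> l i) ->
  \sum_i h i x @[x --> F] --> \sum_i l i.
Proof.
move=> hl; rewrite (_ : (fun s => _) = \sum_i h i); last first.
  by apply/funext => s; rewrite fct_sumE.
apply: (big_ind2 (fun (f : R -> R) a => f x @[x --> F] --> a)) => //.
- exact: (@cvg_cst _ _ _ _ _).
- move=> f a g b fa gb; exact: (cvgD fa gb).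
Qed.

Lemma cvg_coord (F : set_system R) {FF : Filter F} (p : R -> 'M[R]_(n, d))
    (A : 'M[R]_(n, d)) i j : p x @[x --> F] --> A -> p x i j @[x --> F] --> A i j.
Proof.
move=> pA; apply: (@cvg_comp _ _ _ p (fun M : 'M[R]_(n, d) => M i j) _ _ _ pA).
exact: coord_continuous.
Qed.

Lemma mx_norm_le (A : 'M[R]_(n, d)) (B : R) : 0 <= B ->
  (forall i j, `|A i j| <= B) -> `|A| <= B.
Proof.
move=> B0 AB; rewrite [leLHS]mx_normrE.
by apply: bigmax_le => // -[i j] _; exact: AB.
Qed.

Lemma coord_le_mx_norm (A : 'M[R]_(n, d)) i j : `|A i j| <= `|A|.
Proof.
rewrite [leRHS]mx_normrE.
by apply: (le_bigmax _ (fun ij : 'I_n * 'I_d => `|A ij.1 ij.2|) (i, j)).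
Qed.

End Coordinates.

(** * Skew-symmetric generators of rotations in dimensions 2 and 3 *)

Definition skew2 (R : realType) (k : 'I_1) : 'M[R]_2 :=
  \matrix_(i < 2, j < 2) (i%:R - j%:R).

Lemma skew2_inj (R : realType) (v : 'rV[R]_2) (a : 'rV[R]_1) : v != 0 ->
  v *m (\sum_k a 0 k *: skew2 R k) = 0 -> a = 0.
Proof.
move=> v0; rewrite big_ord_recl big_ord0 addr0 => /rowP va.
have := va ord0; have := va (lift ord0 ord0).
rewrite !mxE !big_ord_recl !big_ord0 !mxE /= /bump/=; set o1 := lift _ _.
move=> e0 e1; have [a0|a0] := eqVneq (a 0 ord0) 0.
  by apply/rowP => k; rewrite ord1 a0 mxE.
case/eqP: v0; apply/rowP => k; rewrite mxE; apply: (mulfI a0).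
have : k = ord0 \/ k = o1 by case: k => -[|[|//]] k2; [left|right]; exact: val_inj.
by case=> ->; lra.
Qed.

(** The entries are the Levi-Civita symbol of [(k, i, j)], with indices counted from [0]. *)
Definition skew3 (R : realType) (k : 'I_3) : 'M[R]_3 := \matrix_(i < 3, j < 3)
  ((((k + 1) %% 3 == i) && ((k + 2) %% 3 == j))%N%:R -
   (((k + 1) %% 3 == j) && ((k + 2) %% 3 == i))%N%:R).

(* [v *m \sum_k a 0 k *: skew3 R k] is, up to sign, the cross product of [v] and [a]. *)
Lemma skew3_kernel (R : realType) (v a : 'rV[R]_3) : a != 0 ->
  v *m (\sum_k a 0 k *: skew3 R k) = 0 -> (v <= a)%MS.
Proof.
move=> a0; rewrite !big_ord_recl big_ord0 addr0 => /rowP va.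
have := va 0; have := va 1; have := va ord_max.
rewrite !mxE !big_ord_recl !big_ord0 !mxE /=.
set o1 : 'I_3 := lift _ _; set o2 : 'I_3 := lift _ _ => e2 e1 e0.
have ord3 (k : 'I_3) : [\/ k = ord0, k = o1 | k = o2].
  by case: k => -[|[|[|//]]] k3; [apply: Or31|apply: Or32|apply: Or33]; exact: val_inj.
(* The 2 by 2 minors of [v] and [a] vanish; a nonzero coordinate of [a] then gives the ratio. *)
have va_minor i j : v 0 i * a 0 j = v 0 j * a 0 i.
  by case: (ord3 i) => ->; case: (ord3 j) => ->; lra.
have [j aj0] : exists j, a 0 j != 0.
  by apply/existsP; apply: contraNT a0 => /existsPn aj; apply/eqP/rowP => j;
    rewrite mxE; apply/eqP; rewrite -[_ == _]negbK aj.
suff -> : v = (v 0 j / a 0 j) *: a by exact: scalemx_sub.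
by apply/rowP => i; rewrite mxE mulrAC -va_minor mulfK.
Qed.

Lemma skew2_skew (R : realType) k : (skew2 R k)^T = - skew2 R k.
Proof. by apply/matrixP => i j; rewrite !mxE opprB. Qed.

Lemma skew3_skew (R : realType) k : (skew3 R k)^T = - skew3 R k.
Proof. by apply/matrixP => i j; rewrite !mxE opprB. Qed.

(** In the plane, one nonzero edge vector detects any rotation. In space, a rotation fixing the two
    selected edge vectors would have both on its axis, against their independence. *)
Lemma target_kernel (R : realType) (n d : nat) (E Eo : rel 'I_n)
  (dd : 'I_n -> 'I_n -> R) (phat x : 'M[R]_(n, d)) :
  (2 <= n)%N -> (d = 2%N \/ d = 3%N) ->
  (forall i j, E i j -> 0 < dd i j) ->
  (forall i j, Eo i j -> E i j) ->
  (exists i0 : 'I_n,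
      (d = 2%N -> exists i j, Eo i j) /\
      (d = 3%N -> exists j j', Eo i0 j /\ Eo i0 j' /\
          \rank (col_mx (row j phat - row i0 phat)
                        (row j' phat - row i0 phat)) = 2%N)) ->
  in_M E Eo dd phat x -> inf_rigid E x ->
  forall q : 'M[R]_(n, d),
    (forall i j, E i j -> dot (row j x - row i x) (row j q - row i q) = 0) ->
    (forall i j, Eo i j -> row i q = row j q) ->
    forall i j, row i q = row j q.
Proof.
move=> n2 d23 dd0 EoE [i0 [H2 H3]] [xE xEo] rigid q.
have n0 := ltnW n2.
case: d23 => d23; subst d.
- have [i [j ij]] := H2 erefl.
  apply: (inf_rigid_kernel (J := skew2 R)) => //.
  + by rewrite (leq_trans _ (leq_mul n2 (leqnn 2))).
  + exact: skew2_skew.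
  + move=> a /(_ i j ij); apply: skew2_inj.
    rewrite -sqnorm_eq0 xE; last exact: EoE.
    by rewrite sqrf_eq0 gt_eqF// dd0// EoE.
- have [j [j' [ij [ij' rk2]]]] := H3 erefl.
  apply: (inf_rigid_kernel (J := skew3 R)) => //.
  + by rewrite (leq_mul n2 (leqnn 3)).
  + exact: skew3_skew.
  + move=> a aE; apply/eqP; apply: contraT => a0.
    have sub k : Eo i0 k -> (row k phat - row i0 phat <= a)%MS.
      move=> ik; rewrite -(opprB (row i0 phat)) -xEo// eqmx_opp.
      by apply: skew3_kernel => //; exact: aE.
    have : (\rank a <= 1)%N by exact: rank_leq_row.
    have /mxrankS : (col_mx (row j phat - row i0 phat)
         (row j' phat - row i0 phat) <= a)%MS by rewrite col_mx_sub !sub.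
    by rewrite rk2 => /leq_trans/[apply].
Qed.

(** * Decay of the squared distance along a solution *)

Section Convergence.
Variables (R : realType) (n d : nat) (E Eo : rel 'I_n) (dd : 'I_n -> 'I_n -> R).
Variables (phat x : 'M[R]_(n, d)).
Hypotheses (Esym : forall i j, E i j = E j i)
  (ddsym : forall i j, E i j -> dd i j = dd j i)
  (Eosym : forall i j, Eo i j = Eo j i).
Variable p : R -> 'M[R]_(n, d).
Hypotheses
  (dp : forall t : R, 0 < t -> is_derive t 1 p (formation_field E Eo dd phat (p t)))
  (p0 : p t @[t --> 0^'+] --> p 0).

Lemma centroid_constant (t : R) c : 0 <= t -> \sum_i p t i c = \sum_i p 0 i c.
Proof.
move=> t0; apply: (@constant_right _ (fun s => \sum_i p s i c)) => // [s s0|].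
  rewrite -[X in is_derive _ _ _ X](sum_formation_field phat (p s) Esym ddsym Eosym c).
  by apply: is_derive_pointwise_sum => i; apply: is_derive_coord; exact: dp.
by apply: cvg_pointwise_sum => i; exact: cvg_coord.
Qed.

Let W (t : R) := \sum_i sqnorm (row i (p t - x)).

Lemma is_derive_sqdist (t : R) : 0 < t -> is_derive t 1 W
  (2 * \sum_i dot (row i (p t - x)) (row i (formation_field E Eo dd phat (p t)))).
Proof.
move=> t0; rewrite mulr_sumr.
apply: is_derive_pointwise_sum => i; rewrite dotE mulr_sumr /sqnorm.
apply: is_derive_pointwise_sum => c.
have dpic := is_derive_coord i c (dp t0).
rewrite (_ : (fun s => _) = ((fun s => p s i c) - cst (x i c)) ^+ 2); last first.
  by apply/funext => s; rewrite !mxE/= fctE.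
apply: is_derive_eq.
by rewrite !mxE subr0 expr1 /GRing.scale/= -mulrA.
Qed.

Lemma cvg_sqdist : W t @[t --> 0^'+] --> W 0.
Proof.
apply: cvg_pointwise_sum => i; rewrite /sqnorm; apply: cvg_pointwise_sum => c.
rewrite (_ : (fun s => _) = (fun s => (p s i c - x i c) * (p s i c - x i c))); last first.
  by apply/funext => s; rewrite !mxE expr2.
rewrite !mxE expr2.
by apply: cvgM; (apply: cvgB; [exact: cvg_coord|exact: cvg_cst]).
Qed.

(** Conservation of the centroid keeps [p t - x] centered, so the coercivity bound applies at every
    time. *)
Lemma sqdist_decay (k r : R) : in_M E Eo dd phat x ->
  (forall q, \sum_i row i q = 0 -> k * \sum_i sqnorm (row i q) <=
    \sum_i \sum_(j | E i j) dot (row j x - row i x) (row j q - row i q) ^+ 2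
    + \sum_i \sum_(j | Eo i j) sqnorm (row j q - row i q)) ->
  0 < k -> 40 * n%:R ^+ 2 * r <= k ->
  \sum_i row i (p 0 - x) = 0 -> W 0 < r ->
  forall t : R, 0 <= t -> W t <= W 0 * expR (- (k / 2 * t)).
Proof.
move=> xM kQ k0 rk c0 W0r.
have W0 t : 0 <= W t by apply: sumr_ge0 => i _; exact: sqnorm_ge0.
have ct t : 0 <= t -> \sum_i row i (p t - x) = 0.
  move=> t0; apply/rowP => c; have /rowP/(_ c) := c0.
  have sumE s : (\sum_i row i (p s - x)) 0 c = \sum_i p s i c - \sum_i x i c.
    by rewrite summxE -sumrB; apply: eq_bigr => i _; rewrite !mxE.
  by rewrite !sumE centroid_constant.
apply: (local_gronwall (r := r) _ is_derive_sqdist cvg_sqdist W0 _ W0r); first lra.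
move=> s s0 Wr.
have := formation_field_dissipative Esym ddsym Eosym xM (kQ _ (ct _ (ltW s0))).
rewrite [x + _]addrC subrK -/(W s) => /le_trans; apply.
(* While [W s < r], the remainder [20 n^2 W^2] absorbs at most half of [k W], leaving the rate
   [k / 2]. *)
have nW : 40 * n%:R ^+ 2 * W s <= k.
  by apply: le_trans rk; rewrite ler_wpM2l ?(ltW Wr)// mulr_ge0// sqr_ge0.
have := ler_wpM2r (W0 s) nW; lra.
Qed.

End Convergence.

(** * Choice of the radius, the limit point and the rate *)

Unset Implicit Arguments.

Theorem theorem3 (R : realType) (n d : nat) (E Eo : rel 'I_n)
  (dd : 'I_n -> 'I_n -> R) (phat ptilde : 'M[R]_(n, d)) :
  (2 <= n)%N ->
  (d = 2%N \/ d = 3%N) ->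
  (* undirected simple graph *)
  (forall i j, E i j = E j i) ->
  (forall i, ~~ E i i) ->
  (* desired distances: positive and symmetric *)
  (forall i j, E i j -> 0 < dd i j /\ dd i j = dd j i) ->
  (* orientation edges: a symmetric subset of the edges *)
  (forall i j, Eo i j = Eo j i) ->
  (forall i j, Eo i j -> E i j) ->
  (* desired relative vectors are consistent with the desired distances *)
  (forall i j, Eo i j -> enorm (row j phat - row i phat) = dd i j) ->
  (* selection of orientation edges *)
  (exists i0 : 'I_n,
      (forall i j, Eo i j -> i = i0 \/ j = i0) /\
      (d = 2%N -> exists i j, Eo i j) /\
      (d = 3%N -> exists j j', Eo i0 j /\ Eo i0 j' /\
          \rank (col_mx (row j phat - row i0 phat)
                        (row j' phat - row i0 phat)) = 2%N)) ->
  (* the target formation lies in M and is infinitesimally rigid *)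
  in_M E Eo dd phat ptilde ->
  inf_rigid E ptilde ->
  exists delta : R, 0 < delta /\
    forall p : R -> 'M[R]_(n, d),
      (* p is a solution of the closed-loop system on [0, +oo) *)
      (forall t : R, 0 < t -> is_derive t 1 p (formation_field E Eo dd phat (p t))) ->
      (p x @[x --> 0^'+] --> p 0) ->
      (* initial formation sufficiently close to the target formation *)
      `|p 0 - ptilde| < delta ->
      (* exponential convergence to a point of M *)
      exists pstar : 'M[R]_(n, d), in_M E Eo dd phat pstar /\
        exists C lam : R, 0 < lam /\
          forall t : R, 0 <= t -> `|p t - pstar| <= C * expR (- (lam * t)).
Proof.
move=> n2 d23 Esym Eirr dd_pos Eosym EoE _ [i0 [_ sel]] ptM rigid.
have ddsym i j : E i j -> dd i j = dd j i by move=> /dd_pos[].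
have n0 : 0 < n%:R :> R by rewrite ltr0n ltnW.
have [k k0 kQ] := stiffness_coercive (ltnW n2)
  (target_kernel n2 d23 (fun i j ij => (dd_pos i j ij).1) EoE
     (ex_intro _ i0 sel) ptM rigid).
pose r := k / (40 * n%:R ^+ 2).
have r0 : 0 < r by rewrite divr_gt0// mulr_gt0// exprn_gt0.
(* Each of the [n * d] coordinates of [p 0 - x] will be at most [2 * delta], so the initial squared
   distance is at most [b * delta ^+ 2 < r]. *)
pose b : R := n%:R * (d%:R * 4).
have b0 : 0 <= b by rewrite !mulr_ge0.
pose delta := Num.sqrt (r / (1 + b)).
have rb0 : 0 < r / (1 + b) by rewrite divr_gt0// ltr_pwDl.
exists delta; split; first by rewrite sqrtr_gt0.
move=> p dp p0 pdelta.
(* [s] is the initial centroid offset from [ptilde], and [x] shifts every agent of the target by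
   [s]. *)
pose s : 'rV[R]_d := n%:R^-1 *: \sum_i row i (p 0 - ptilde).
pose x := ptilde + (const_mx 1 : 'cV_n) *m s.
have rowx i : row i x = row i ptilde + s.
  rewrite /x linearD/= row_mul; congr (_ + _).
  by apply/rowP => c; rewrite mxE big_ord1 !mxE mul1r.
have diffx i j : row i x - row j x = row i ptilde - row j ptilde.
  by rewrite !rowx opprD addrACA subrr addr0.
have xM : in_M E Eo dd phat x.
  by case: ptM => ptE ptEo; split=> i j ij; rewrite diffx ?ptE ?ptEo.
have rowq i : row i (p 0 - x) = row i (p 0 - ptilde) - s.
  by rewrite !linearB/= rowx opprD addrA.
have centered : \sum_i row i (p 0 - x) = 0.
  under eq_bigr do rewrite rowq.
  rewrite sumrB sumr_const card_ord /s -scaler_nat scalerA divff ?gt_eqF//.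
  by rewrite scale1r subrr.
have delta0 : 0 <= delta by exact: sqrtr_ge0.
have coord i c : `|(p 0 - ptilde) i c| <= delta.
  by rewrite (le_trans (coord_le_mx_norm _ _ _))// ltW.
have s_le c : `|s 0 c| <= delta.
  rewrite mxE summxE normrM (ger0_norm (_ : 0 <= n%:R^-1)) ?invr_ge0 ?(ltW n0)//.
  rewrite ler_pdivrMl// (le_trans (ler_norm_sum _ _ _))//.
  apply: (@le_trans _ _ (\sum_(i < n) delta)); last by rewrite sumr_const card_ord mulr_natl.
  by apply: ler_sum => i _; rewrite [row _ _ _ _]mxE.
have W0r : \sum_i sqnorm (row i (p 0 - x)) < r.
  apply: (@le_lt_trans _ _ (b * delta ^+ 2)); last first.
    rewrite sqr_sqrtr ?(ltW rb0)// mulrCA gtr_pMr// ltr_pdivrMr ?ltr_pwDl//.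
    by rewrite mul1r ltrDr.
  have -> : b * delta ^+ 2 = \sum_(i < n) \sum_(c < d) 4 * delta ^+ 2.
    rewrite !sumr_const !card_ord -[RHS]mulr_natr -(mulr_natr (4 * delta ^+ 2) d).
    by rewrite /b; ring.
  apply: ler_sum => i _; apply: ler_sum => c _; rewrite rowq.
  have qic : `|(row i (p 0 - ptilde) - s) 0 c| <= 2 * delta.
    have -> : (row i (p 0 - ptilde) - s) 0 c = (p 0 - ptilde) i c - s 0 c.
      by rewrite mxE [row _ _ _ _]mxE; congr (_ + _); rewrite mxE.
    by rewrite (le_trans (ler_normB _ _))// mulr_natl mulr2n lerD.
  have -> : 4 * delta ^+ 2 = (2 * delta) ^+ 2 by ring.
  by rewrite -[leLHS]real_normK ?num_real// lerXn2r ?nnegrE ?mulr_ge0.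
(* The form sees only differences of positions, so the [k] found for [ptilde] serves every
   translate; hence [delta] does not depend on [p]. *)
have kQx q : \sum_i row i q = 0 -> k * \sum_i sqnorm (row i q) <=
    \sum_i \sum_(j | E i j) dot (row j x - row i x) (row j q - row i q) ^+ 2
    + \sum_i \sum_(j | Eo i j) sqnorm (row j q - row i q).
  move=> /kQ /le_trans; apply; rewrite lerD2r le_eqVlt; apply/predU1P; left.
  by do 2![apply: eq_bigr => ? _]; rewrite diffx.
have rk : 40 * n%:R ^+ 2 * r <= k.
  by rewrite /r mulrC divfK// gt_eqF// mulr_gt0// exprn_gt0.
have decay := sqdist_decay Esym ddsym Eosym dp p0 xM kQx k0 rk centered W0r.
exists x; split=> //.
set W0 := \sum_i sqnorm (row i (p 0 - x)) in decay.
(* Taking the square root of the decay of [W] halves the rate [k / 2]. *)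
exists (Num.sqrt W0), (k / 4); split; first by rewrite divr_gt0.
move=> t t0; have W00 : 0 <= W0 by apply: sumr_ge0 => i _; exact: sqnorm_ge0.
apply: mx_norm_le => [|i c]; first by rewrite mulr_ge0 ?sqrtr_ge0 ?expR_ge0.
rewrite -(ger0_norm (mulr_ge0 (sqrtr_ge0 W0) (expR_ge0 _))) -!sqrtr_sqr.
rewrite ler_wsqrtr// exprMn sqr_sqrtr// (expr2 (expR _)) -expRD.
rewrite (_ : _ + _ = - (k / 2 * t)); last by field.
apply: le_trans (decay t t0).
rewrite (bigD1 i)//= ler_wpDr ?sumr_ge0// => [j _|]; first exact: sqnorm_ge0.
rewrite /sqnorm (bigD1 c)//= [row _ _ _ _]mxE ler_wpDr ?sumr_ge0// => j _.
exact: sqr_ge0.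
Qed.
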